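(* Let $G$ be a finite simple graph that is $\{K_5-e, P_3\cup K_1\}$-free. Then $\chi(G)\le \omega(G)+1$.
   Context: $\chi(G)$ is the chromatic number and $\omega(G)$ the clique number. $K_5-e$ is the complete graph on five vertices with one edge removed. $P_3\cup K_1$ is the disjoint union of a path on three vertices and an isolated vertex. A graph is $\{H_1,\dots,H_k\}$-free if it has no induced subgraph isomorphic to any $H_i$. *)

(* Defs.v *)
From HB Require Import structures.
From mathcomp Require Import all_boot.

Set Implicit Arguments.
Unset Strict Implicit.
Unset Printing Implicit Defensive.

Record sgraph := SGraph {
  vertex :> finType;
  adj : rel vertex;
  adj_sym : symmetric adj;
  adj_irr : irreflexive adj }.

Lemma induced_sym (G : sgraph) (S : {set G}) :
  symmetric (fun x y : {x : G | x \in S} => adj (val x) (val y)).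
Proof. by move=> x y; apply: adj_sym. Qed.

Lemma induced_irr (G : sgraph) (S : {set G}) :
  irreflexive (fun x y : {x : G | x \in S} => adj (val x) (val y)).
Proof. by move=> x; apply: adj_irr. Qed.

Definition induced (G : sgraph) (S : {set G}) : sgraph :=
  SGraph (@induced_sym G S) (@induced_irr G S).

Definition isomorphic (G H : sgraph) : Prop :=
  exists2 f : G -> H, bijective f & {mono f : x y / adj x y}.

Definition induced_free (H G : sgraph) : Prop :=
  ~ exists S : {set G}, isomorphic H (induced S).

Definition clique (G : sgraph) (A : {set G}) : bool :=
  [forall x in A, forall y in A, (x != y) ==> adj x y].

Definition clique_number (G : sgraph) : nat :=
  \max_(A : {set G} | clique A) #|A|.

Definition proper_coloring (G : sgraph) (k : nat) (c : {ffun G -> 'I_k}) : bool :=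
  [forall x, forall y, adj x y ==> (c x != c y)].

Definition colorable (G : sgraph) (k : nat) : bool :=
  [exists c : {ffun G -> 'I_k}, proper_coloring c].

Lemma ex_colorable (G : sgraph) : exists k, colorable G k.
Proof.
exists #|G|; apply/existsP; exists [ffun x => enum_rank x].
apply/forallP=> x; apply/forallP=> y; apply/implyP=> xy.
rewrite !ffunE; apply/eqP=> /enum_rank_inj exy.
by rewrite exy adj_irr in xy.
Qed.

Definition chromatic_number (G : sgraph) : nat := ex_minn (ex_colorable G).

Definition complete_adj (n : nat) : rel 'I_n := fun i j => i != j.

Lemma complete_sym n : symmetric (@complete_adj n).
Proof. by move=> i j; rewrite /complete_adj eq_sym. Qed.

Lemma complete_irr n : irreflexive (@complete_adj n).
Proof. by move=> i; rewrite /complete_adj eqxx. Qed.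

Definition complete_graph (n : nat) : sgraph :=
  SGraph (@complete_sym n) (@complete_irr n).

(* The path on n vertices (not n edges). *)
Definition path_adj (n : nat) : rel 'I_n :=
  fun i j => (i.+1 == j :> nat) || (j.+1 == i :> nat).

Lemma path_sym n : symmetric (@path_adj n).
Proof. by move=> i j; rewrite /path_adj orbC. Qed.

Lemma path_irr n : irreflexive (@path_adj n).
Proof. by move=> i; rewrite /path_adj orbb -[X in _ == X]addn0 -addn1 eqn_add2l. Qed.

Definition path_graph (n : nat) : sgraph :=
  SGraph (@path_sym n) (@path_irr n).

Definition union_adj (G H : sgraph) : rel (G + H)%type := fun u v =>
  match u, v with
  | inl x, inl y => adj x y
  | inr x, inr y => adj x y
  | _, _ => false
  end.

Lemma union_sym (G H : sgraph) : symmetric (@union_adj G H).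
Proof. by move=> [x|x] [y|y] //=; apply: adj_sym. Qed.

Lemma union_irr (G H : sgraph) : irreflexive (@union_adj G H).
Proof. by move=> [x|x] /=; apply: adj_irr. Qed.

Definition disjoint_union (G H : sgraph) : sgraph :=
  SGraph (@union_sym G H) (@union_irr G H).

Definition del_edge_adj (G : sgraph) (a b : G) : rel G :=
  fun x y => adj x y && ([set x; y] != [set a; b]).

Lemma del_edge_sym (G : sgraph) (a b : G) : symmetric (del_edge_adj a b).
Proof. by move=> x y; rewrite /del_edge_adj adj_sym setUC. Qed.

Lemma del_edge_irr (G : sgraph) (a b : G) : irreflexive (del_edge_adj a b).
Proof. by move=> x; rewrite /del_edge_adj adj_irr. Qed.

Definition del_edge (G : sgraph) (a b : G) : sgraph :=
  SGraph (del_edge_sym a b) (del_edge_irr a b).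

Definition K5_minus_e : sgraph :=
  @del_edge (complete_graph 5) (ord0 : 'I_5) (ord_max : 'I_5).

Definition P3_union_K1 : sgraph :=
  disjoint_union (path_graph 3) (complete_graph 1).

(* Main.v *)
(** If some stable set has at least three vertices, take a largest one, I. As G
    is (P3 u K1)-free, a vertex outside I sees either all of I or exactly one
    vertex of I, and every clique disjoint from I is completely joined to some
    vertex of I. So deleting I lowers the clique number, and induction applies.

    Otherwise the complement H of G is triangle-free, and an optimal colouring
    of G is a maximum matching of H. Let U be its set of unmatched vertices.
    Alternating paths show that every vertex whose partner has an H-neighbour
    in U is G-complete to U. If |U| > 2, these vertices form with U a clique
    with one vertex per colour. If |U| <= 2, then chi = (n + |U|)/2 and the
    Ramsey-type bound n <= 2 omega + 2 suffices, except when |U| = 2 and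
    n = 2 omega + 2; then omega is 3 or 4, all degrees are at most omega + 2,
    and the same vertices would form a clique of size omega + 1. The case
    n = 2 omega + 3 of the bound falls to double counting: G would be 5-regular
    on 9 vertices, or have 11 vertices, each of them in exactly two K4s. *)

Require Import Defs.
From mathcomp Require Import all_boot zify.

Set Implicit Arguments.
Unset Strict Implicit.
Unset Printing Implicit Defensive.

(** * Forbidden subgraphs, cliques and colourings *)

Definition neighbors (G : sgraph) (x : G) : {set G} := [set y | adj x y].

(** A triangle in the common neighbourhood of two nonadjacent vertices spans K5 - e with them.
    Allowing any larger clique [T] spares choosing the triangle. *)
Definition no_K5e (G : sgraph) : Prop := forall (a b : G) (T : {set G}),
  a != b -> ~~ adj a b -> clique T -> 2 < #|T| ->
  T \subset neighbors a :&: neighbors b -> False.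

(** That [w] is off the path need not be required: each vertex of the path is adjacent to another
    one, and [w] to none. *)
Definition no_P3K1 (G : sgraph) : Prop := forall x y z w : G,
  x != z -> adj x y -> adj y z -> ~~ adj x z ->
  ~~ adj w x -> ~~ adj w y -> ~~ adj w z -> False.

(** Equivalently, the complement is triangle-free. *)
Definition alpha_le2 (G : sgraph) : Prop := forall x y z : G,
  x != y -> x != z -> y != z -> [|| adj x y, adj x z | adj y z].

Lemma adj_neq (G : sgraph) (x y : G) : adj x y -> x != y.
Proof. by apply: contraTneq => ->; rewrite adj_irr. Qed.

Lemma cliqueP (G : sgraph) (A : {set G}) :
  reflect {in A &, forall x y, x != y -> adj x y} (clique A).
Proof.
apply: (iffP forall_inP) => [h x y xA yA | h x xA].
  by move/forall_inP: (h x xA) => /(_ y yA) /implyP.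
by apply/forall_inP => y yA; apply/implyP; apply: h.
Qed.

Lemma cliqueS (G : sgraph) (A B : {set G}) :
  A \subset B -> clique B -> clique A.
Proof.
by move=> /subsetP sAB /cliqueP cB; apply/cliqueP=> x y /sAB xB /sAB; apply: cB.
Qed.

Lemma cliqueU1 (G : sgraph) (x : G) (A : {set G}) :
  clique A -> {in A, forall y, x != y -> adj x y} -> clique (x |: A).
Proof.
move=> /cliqueP cA xA; apply/cliqueP=> y z /setU1P[->|yA] /setU1P[->|zA].
- by rewrite eqxx.
- exact: xA.
- by rewrite adj_sym eq_sym; apply: xA.
- exact: cA.
Qed.

Lemma clique_le (G : sgraph) (A : {set G}) :
  clique A -> #|A| <= clique_number G.
Proof. by move=> cA; apply: (@leq_bigmax_cond _ _ (fun A : {set G} => #|A|)). Qed.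

Lemma max_clique (G : sgraph) :
  exists2 A : {set G}, clique A & #|A| = clique_number G.
Proof.
have [|A cA eA] := @eq_bigmax_cond _ [pred A : {set G} | clique A] (fun A => #|A|).
  apply/card_gt0P; exists set0; rewrite inE.
  by apply/cliqueP=> x y; rewrite inE.
by exists A.
Qed.

Lemma chromatic_number_le (G : sgraph) k : colorable G k -> chromatic_number G <= k.
Proof. by rewrite /chromatic_number; case: ex_minnP => m _ min_m; apply: min_m. Qed.

(** Lets the vertices of [G] serve as colours: a colour is renumbered by its position in
    [enum R]. *)
Lemma colorable_image (G : sgraph) (T : finType) (c : G -> T) (R : {set T}) k :
  (forall x, c x \in R) -> (forall x y, adj x y -> c x != c y) -> #|R| <= k ->
  colorable G k.
Proof.
move=> cR c_proper leRk; apply/existsP.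
pose r x := enum_rank_in (cR x) (c x).
have ltr x : index (c x) (enum R) < k.
  by rewrite (leq_trans _ leRk) // cardE index_mem mem_enum.
exists [ffun x => Ordinal (ltr x)].
apply/forallP=> x; apply/forallP=> y; apply/implyP=> xy; rewrite !ffunE.
apply: contraNneq (c_proper x y xy) => /(congr1 val) /= e.
by rewrite -(nth_index (c x) (_ : c x \in enum R)) ?e ?nth_index ?mem_enum.
Qed.

Lemma induced_copy (H G : sgraph) (g : H -> G) :
  injective g -> {mono g : x y / adj x y} -> ~ induced_free H G.
Proof.
move=> g_inj g_mono; apply; exists [set g x | x in H].
have gS x : g x \in [set g x | x in H] by apply: imset_f.
exists (fun x => exist _ (g x) (gS x) : induced _); last by move=> x y; apply: g_mono.
apply: inj_card_bij => [x y /(congr1 val) /g_inj //|].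
by rewrite card_sig card_imset.
Qed.

Lemma no_K5e_of_free (G : sgraph) : induced_free K5_minus_e G -> no_K5e G.
Proof.
move=> free a b T ab nab /cliqueP cT /card_gt2P[c [d [e [[cIn dIn eIn] [cd de ec]]]]].
move=> /subsetP sT.
have := sT c cIn; have := sT d dIn; have := sT e eIn; rewrite !inE.
move=> /andP[ae be] /andP[ad bd] /andP[ac bc].
have acd := cT _ _ cIn dIn cd; have ade := cT _ _ dIn eIn de.
have aec := cT _ _ eIn cIn ec.
(* The nonadjacent vertices [a] and [b] come first and last, since the deleted edge joins [ord0] and
   [ord_max]. *)
pose g (i : K5_minus_e) := nth a [:: a; c; d; e; b] (i : 'I_5).
apply: (@induced_copy K5_minus_e G g) free.
- have: uniq [:: a; c; d; e; b].
    rewrite /= !inE !negb_or ab cd de (eq_sym c) ec !(eq_sym _ b).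
    by rewrite !adj_neq.
  move=> un x y /eqP; rewrite nth_uniq ?(ltn_ord x) ?(ltn_ord y) //.
  by move=> /eqP /val_inj.
- have E (x y : 'I_5) : ([set x; y] == [set ord0; ord_max]) =
     ((x == ord0) && (y == ord_max)) || ((x == ord_max) && (y == ord0)).
    apply/eqP/idP => [/setP h|]; last first.
      by case/orP=> /andP[/eqP-> /eqP->] //; rewrite setUC.
    have := h ord0; have := h ord_max; have := h x; have := h y.
    by rewrite !inE !eqxx !orbT /= !(eq_sym ord0) !(eq_sym ord_max);
       do 4?case: eqP => //= ?; subst.
  move=> x y; rewrite /= /del_edge_adj E /= /complete_adj.
  case: x => [] [|[|[|[|[|//]]]]] ?; case: y => [] [|[|[|[|[|//]]]]] ?;
  rewrite /g /= ?adj_irr //;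
  by [|rewrite adj_sym|apply/negbTE; rewrite // adj_sym].
Qed.

Lemma no_P3K1_of_free (G : sgraph) : induced_free P3_union_K1 G -> no_P3K1 G.
Proof.
move=> free x y z w xz xy yz nxz nwx nwy nwz.
pose g (s : P3_union_K1) := 
  match s : 'I_3 + 'I_1 with inl i => nth x [:: x; y; z] i | inr _ => w end.
apply: (@induced_copy P3_union_K1 G g) free.
- have wx : w == x = false by apply: contraNF nwy => /eqP->.
  have wz : w == z = false by apply: contraNF nwy => /eqP->; rewrite adj_sym.
  have wy : w == y = false by apply: contraNF nwx => /eqP->; rewrite adj_sym.
  have exy := adj_neq xy. have eyz := adj_neq yz.
  move=> [] [i lti] [] [j ltj] /eqP; rewrite /g.
  + case: i lti => [|[|[|//]]] ?; case: j ltj => [|[|[|//]]] ? /=;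
    rewrite ?(negbTE exy) ?(negbTE eyz) ?(negbTE xz) 1?eq_sym
       ?(negbTE exy) ?(negbTE eyz) ?(negbTE xz) // => _; congr inl; exact: val_inj.
  + by case: i lti => [|[|[|//]]] ?; rewrite /= eq_sym ?wx ?wy ?wz.
  + by case: j ltj => [|[|[|//]]] ?; rewrite /= ?wx ?wy ?wz.
  + by move=> _; congr inr; apply/val_inj; case: i j lti ltj => [|//] [|//].
- move=> [] [i lti] [] [j ltj]; rewrite /g /= /path_adj /complete_adj -?val_eqE.
  + case: i lti => [|[|[|//]]] ?; case: j ltj => [|[|[|//]]] ? /=; rewrite ?adj_irr //;
    by [|rewrite adj_sym|apply/negbTE; rewrite // adj_sym].
  + case: i lti => [|[|[|//]]] ? /=; apply/negbTE; by rewrite // adj_sym.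
  + case: j ltj => [|[|[|//]]] ? /=; apply/negbTE; by rewrite // adj_sym.
  + by case: i j lti ltj => [|//] [|//]; rewrite /= adj_irr.
Qed.

(** * Maximum matchings of the complement *)

(* A matching of the complement graph, as an involution whose fixed points are
   the unmatched vertices. *)
Definition comatching (G : sgraph) (f : {ffun G -> G}) : bool :=
  [forall x, (f (f x) == x) && ~~ adj x (f x)].

Definition unmatched (G : sgraph) (f : {ffun G -> G}) : {set G} :=
  [set x | f x == x].

Definition max_comatching (G : sgraph) (f : {ffun G -> G}) : Prop :=
  comatching f /\ forall g : {ffun G -> G}, comatching g -> #|unmatched f| <= #|unmatched g|.

(* Swaps the unmatched vertex u for the mate of its non-neighbour y; when y is
   itself unmatched, this matches u with y. *)
Definition rotate (G : sgraph) (f : {ffun G -> G}) (u y : G) : {ffun G -> G} :=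
  [ffun z => if z == u then y else if z == y then u
             else if z == f y then z else f z].

Lemma comatchingK (G : sgraph) (f : {ffun G -> G}) : comatching f -> involutive f.
Proof. by move=> /forallP hf x; have /andP[/eqP] := hf x. Qed.

Lemma comatching_nadj (G : sgraph) (f : {ffun G -> G}) x :
  comatching f -> ~~ adj x (f x).
Proof. by move=> /forallP hf; have /andP[] := hf x. Qed.

Lemma unmatched_mate (G : sgraph) (f : {ffun G -> G}) x :
  comatching f -> (f x \in unmatched f) = (x \in unmatched f).
Proof. by move=> hf; rewrite !inE comatchingK // eq_sym. Qed.

Lemma ex_max_comatching (G : sgraph) : exists f : {ffun G -> G}, max_comatching f.
Proof.
have id_co : comatching [ffun x : G => x].
  by apply/forallP=> x; rewrite !ffunE eqxx adj_irr.
have [f f_co f_min] := arg_minnP (fun f => #|unmatched f|) id_co.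
by exists f.
Qed.

Lemma rotate_comatching (G : sgraph) (f : {ffun G -> G}) u y :
  comatching f -> u \in unmatched f -> ~~ adj u y -> comatching (rotate f u y).
Proof.
move=> hf; rewrite inE => /eqP fu nuy; have fK := comatchingK hf.
apply/forallP=> x; rewrite !ffunE.
case: (eqVneq x u) => [->|xu].
  by case: (eqVneq y u) => [->|yu]; rewrite !eqxx ?adj_irr ?nuy.
case: (eqVneq x y) => [->|xy]; first by rewrite !eqxx adj_sym.
case: (eqVneq x (f y)) => [xfy|xfy].
  by rewrite (negbTE xu) (negbTE xy) xfy eqxx eqxx adj_irr.
rewrite comatching_nadj // andbT.
case: (eqVneq (f x) u) => [e|_]; first by rewrite -(fK x) e fu eqxx in xu.
case: (eqVneq (f x) y) => [e|_]; first by rewrite -(fK x) e eqxx in xfy.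
case: (eqVneq (f x) (f y)) => [/(can_inj fK) e|_]; first by rewrite e eqxx in xy.
by rewrite fK.
Qed.

(** Two nonadjacent unmatched vertices could be matched with each other. *)
Lemma max_unmatched_adj (G : sgraph) (f : {ffun G -> G}) u v :
  max_comatching f -> u \in unmatched f -> v \in unmatched f -> u != v -> adj u v.
Proof.
move=> [hf f_min] uU vU uv; apply: contraT => nuv.
have := f_min _ (rotate_comatching hf uU nuv); rewrite leqNgt => /negP[].
apply: (@leq_ltn_trans #|unmatched f :\ u|); last first.
  by rewrite [X in _ < X](cardsD1 u) uU.
apply/subset_leq_card/subsetP=> z; rewrite !inE ffunE.
move: vU; rewrite inE => /eqP fv; rewrite fv.
case: (eqVneq z u) => [->|zu]; first by rewrite eq_sym (negbTE uv).
by case: (eqVneq z v) => [->|zv] /=; rewrite ?(negbTE uv).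
Qed.

(** By maximality [y] is matched, so u - y - f y is an alternating path of even length; flipping it
    frees [f y] in place of [u] and keeps the size of the matching. *)
Lemma rotate_max (G : sgraph) (f : {ffun G -> G}) u y :
    max_comatching f -> u \in unmatched f -> y != u -> ~~ adj u y ->
  max_comatching (rotate f u y) /\
  unmatched (rotate f u y) = f y |: (unmatched f :\ u).
Proof.
move=> hmax uU yu nuy; have [hf f_min] := hmax.
have yU : y \notin unmatched f.
  by apply: contra nuy => yU; apply: (max_unmatched_adj hmax); rewrite // eq_sym.
have fyU : f y \notin unmatched f by rewrite unmatched_mate.
have eqU : unmatched (rotate f u y) = f y |: (unmatched f :\ u).
  apply/setP=> z; rewrite !inE ffunE.
  have fyu : f y != u by apply: contraNneq fyU => ->.
  case: (eqVneq z u) => [->|zu]; first by rewrite (negbTE yu) eq_sym (negbTE fyu).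
  case: (eqVneq z y) => [->|zy].
    rewrite inE in yU; rewrite (negbTE yU) orbF eq_sym (negbTE yu).
    by rewrite eq_sym (negbTE yU).
  by case: (eqVneq z (f y)) => [->|//]; rewrite eqxx.
split=> //; split; first exact: rotate_comatching.
move=> g /f_min; apply: leq_trans; rewrite eqU cardsU1 !inE.
rewrite inE in fyU; rewrite (negbTE fyU) andbF [X in _ <= X](cardsD1 u) uU.
by [].
Qed.

(** For [v] other than [u], rotating leaves both [f y] and [v] unmatched in a maximum matching. For
    [v = u], a missing edge would make u, y, f y a triangle of the complement. *)
Lemma mate_adj_unmatched (G : sgraph) (f : {ffun G -> G}) u y v :
    alpha_le2 G -> max_comatching f -> u \in unmatched f -> y \notin unmatched f ->
  ~~ adj u y -> v \in unmatched f -> adj (f y) v.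
Proof.
move=> a2 hmax uU yU nuy vU; have [hf _] := hmax.
have yu : y != u by apply: contraNneq yU => ->.
have fyU : f y \notin unmatched f by rewrite unmatched_mate.
case: (eqVneq v u) => [->|vu]; last first.
  have [hmax' eqU'] := rotate_max hmax uU yu nuy.
  apply: (max_unmatched_adj hmax').
  - by rewrite eqU' setU11.
  - by rewrite eqU' in_setU1 in_setD1 vu vU orbT.
  - by apply: contraNneq fyU => ->.
have := a2 (f y) u y; rewrite (adj_sym u y : _ = _) [adj y u]adj_sym (negbTE nuy).
rewrite [adj (f y) y]adj_sym (negbTE (comatching_nadj _ hf)) !orbF; apply.
- by apply: contraNneq fyU => ->.
- by move: yU; rewrite inE.
- by rewrite eq_sym.
Qed.

(* Otherwise u - y - f y - f y' - y' - u' is an augmenting path of the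
   complement. *)
Lemma mates_adj (G : sgraph) (f : {ffun G -> G}) u u' y y' :
    alpha_le2 G -> max_comatching f ->
    u \in unmatched f -> u' \in unmatched f -> u != u' ->
    y \notin unmatched f -> y' \notin unmatched f -> y != y' ->
  ~~ adj u y -> ~~ adj u' y' -> adj (f y) (f y').
Proof.
move=> a2 hmax uU u'U uu' yU y'U yy' nuy nu'y'; have [hf _] := hmax.
have fK := comatchingK hf.
have yu : y != u by apply: contraNneq yU => ->.
have [hmax' eqU'] := rotate_max hmax uU yu nuy.
have fyU : f y \notin unmatched f by rewrite unmatched_mate.
have fy'U : f y' \notin unmatched f by rewrite unmatched_mate.
have fyy' : f y != f y' by rewrite (inj_eq (can_inj fK)).
apply: contraT => nff.
have fy'u : f y' != u by apply: contraNneq fy'U => ->.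
have fy'y : f y' != y.
  apply: contraNneq nu'y' => e; rewrite -(fK y') e adj_sym.
  exact: (mate_adj_unmatched a2 hmax uU).
have E : rotate f u y (f y') = y'.
  by rewrite ffunE (negbTE fy'u) (negbTE fy'y) eq_sym (negbTE fyy') fK.
(* In the rotated matching [f y] is unmatched and misses [f y'], whose mate is still [y']; hence
   [y'] would see [u']. *)
have: adj (rotate f u y (f y')) u'.
  apply: (mate_adj_unmatched a2 hmax' _ _ nff).
  - by rewrite eqU' setU11.
  - by rewrite eqU' in_setU1 in_setD1 (negbTE fy'U) andbF orbF eq_sym.
  - by rewrite eqU' in_setU1 in_setD1 u'U (eq_sym u' u) uu' orbT.
by rewrite E adj_sym (negbTE nu'y').
Qed.

(** The mates of these vertices are the ends of the alternating paths u - y - f y of the complement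
    that start at an unmatched [u]. *)
Definition exposed (G : sgraph) (f : {ffun G -> G}) : {set G} :=
  [set y in ~: unmatched f | [exists u in unmatched f, ~~ adj u y]].

Lemma exposedP (G : sgraph) (f : {ffun G -> G}) y :
  reflect (y \notin unmatched f /\ exists2 u, u \in unmatched f & ~~ adj u y)
          (y \in exposed f).
Proof.
rewrite !inE; apply: (iffP andP) => [[yU /exists_inP[u uU nuy]]|[yU [u uU nuy]]].
  by split=> //; exists u.
by split=> //; apply/exists_inP; exists u.
Qed.

(** The unmatched vertices and the mates of the exposed ones form the clique. Only adjacency among
    the mates must be assumed; maximality gives all other pairs. *)
Lemma clique_unmatched_mates (G : sgraph) (f : {ffun G -> G}) :
    alpha_le2 G -> max_comatching f ->
    {in exposed f &, forall y y', y != y' -> adj (f y) (f y')} ->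
  #|unmatched f| + #|exposed f| <= clique_number G.
Proof.
move=> a2 hmax hY; have [hf _] := hmax.
have fK := comatchingK hf.
have <- : #|f @: exposed f| = #|exposed f| by apply: card_imset (can_inj fK).
rewrite -cardsUI.
have -> : unmatched f :&: f @: exposed f = set0.
  apply/setP=> z; rewrite in_setI in_set0; apply/andP=> -[zU /imsetP[y /exposedP[yU _] e]].
  by rewrite e unmatched_mate // (negbTE yU) in zU.
rewrite cards0 addn0; apply: clique_le; apply/cliqueP=> a b.
have UY u y : u \in unmatched f -> y \in exposed f -> adj (f y) u.
  by move=> uU /exposedP[yU [v vU nvy]]; apply: (mate_adj_unmatched a2 hmax vU).
move=> /setUP[aU|/imsetP[y yY ->]] /setUP[bU|/imsetP[y' y'Y ->]] ab.
- exact: (max_unmatched_adj hmax).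
- by rewrite adj_sym UY.
- exact: UY.
- by apply: hY => //; apply: contraNneq ab => ->.
Qed.

(** The colour classes are the unmatched vertices and the matched pairs. Each pair has an exposed
    end, so the clique of [clique_unmatched_mates] has a vertex in every class. *)
Lemma colorable_unmatched_ge3 (G : sgraph) (f : {ffun G -> G}) :
    alpha_le2 G -> no_K5e G -> max_comatching f -> 2 < #|unmatched f| ->
  colorable G (clique_number G).
Proof.
move=> a2 k5 hmax U3; have [hf _] := hmax.
have fK := comatchingK hf.
have cU : clique (unmatched f).
  by apply/cliqueP=> x y xU yU; apply: (max_unmatched_adj hmax).
have hY : {in exposed f &, forall y y', y != y' -> adj (f y) (f y')}.
  move=> y y' /exposedP[yU [u uU nuy]] /exposedP[y'U [u' u'U nu'y']] yy'.
  apply: contraT => nff.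
  (* By [mates_adj], nonadjacent mates force one common vertex [u]: every other unmatched vertex
     sees both [y] and [y']. *)
  have only v v' : v \in unmatched f -> v' \in unmatched f ->
      ~~ adj v y -> ~~ adj v' y' -> v = v'.
    move=> vU v'U nvy nv'y'; apply/eqP; apply: contraNT nff => vv'.
    exact: (mates_adj a2 hmax vU v'U).
  have uu' : u = u' by apply: only.
  rewrite -{u' u'U}uu' in nu'y'.
  have yu : y != u by apply: contraNneq yU => ->.
  have y'u : y' != u by apply: contraNneq y'U => ->.
  have yy'adj : adj y y'.
    have := a2 y y' u yy' yu y'u.
    by rewrite ![adj _ u]adj_sym (negbTE nuy) (negbTE nu'y') !orbF.
  have fyy' : f y != y'.
    apply: contraNneq nu'y' => <-; rewrite adj_sym.
    exact: (mate_adj_unmatched a2 hmax uU).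
  have fyy'adj : adj (f y) y'.
    have := a2 (f y) (f y') y'; rewrite (negbTE nff) /=.
    rewrite [adj (f y') y']adj_sym (negbTE (comatching_nadj _ hf)) orbF; apply=> //.
    - by rewrite (inj_eq (can_inj fK)).
    - by move: y'U; rewrite inE.
  (* In the complement, u, y, f y, f y', y' is a 5-cycle. *)
  case: (k5 y (f y) (y' |: (unmatched f :\ u))).
  - by move: yU; rewrite inE eq_sym.
  - exact: comatching_nadj.
  - apply: cliqueU1; first by apply: cliqueS cU; apply: subD1set.
    move=> v /setD1P[vu vU] _; apply: contraT => ny'v.
    by case/eqP: vu; apply/esym/only; rewrite // adj_sym.
  - rewrite cardsU1 in_setD1 (negbTE y'U) andbF.
    by have /= := cardsD1 u (unmatched f); rewrite uU /= => <-.
  - apply/subsetP=> v /setU1P[->|/setD1P[vu vU]]; rewrite !inE.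
      by rewrite yy'adj fyy'adj.
    rewrite (mate_adj_unmatched a2 hmax uU) // andbT.
    apply: contraT => nyv; case/eqP: vu; apply: (only) => //; by rewrite adj_sym.
have leq_k := clique_unmatched_mates a2 hmax hY.
(* The mate of the exposed end is the colour of a pair. *)
apply: (@colorable_image _ _ (fun x => if x \in exposed f then f x else x)
          (unmatched f :|: f @: exposed f)).
- move=> x; case: ifP => [xY|xY]; rewrite in_setU ?[f x \in f @: _]imset_f ?orbT //.
  case: (boolP (x \in unmatched f)) => //= xU.
  have full z : z \notin unmatched f -> z \notin exposed f ->
      {in unmatched f, forall u, adj z u}.
    move=> zU zY u uU; apply: contraT => nzu; case/negP: zY; apply/exposedP; split=> //.
    by exists u; rewrite // adj_sym.
  apply/imsetP; exists (f x); last by rewrite fK.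
  (* If neither end of a pair is exposed, both see the whole clique of at least three unmatched
     vertices. *)
  apply: contraT => fxY; exfalso.
  apply: (k5 x (f x) (unmatched f)) => //.
  + by move: xU; rewrite inE eq_sym.
  + exact: comatching_nadj.
  + apply/subsetP=> u uU; rewrite !inE !full ?unmatched_mate ?xY //.
- move=> x y xy; have nxy := adj_neq xy.
  case: ifP => _; case: ifP => _ //.
  + by rewrite (inj_eq (can_inj fK)).
  + by apply: contraTneq xy => <-; rewrite comatching_nadj.
  + by apply: contraTneq xy => ->; rewrite adj_sym comatching_nadj.
- apply: leq_trans leq_k; 
  have <- : #|f @: exposed f| = #|exposed f| by apply: card_imset (can_inj fK).
  by rewrite -cardsUI leq_addr.
Qed.

(** There are (n + |U|)/2 classes, where U is the set of unmatched vertices. This is an integer, so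
    the odd bound [k.*2.+1] suffices. *)
Lemma colorable_comatching (G : sgraph) (f : {ffun G -> G}) k :
  comatching f -> #|G| + #|unmatched f| <= k.*2.+1 -> colorable G k.
Proof.
move=> hf le_k; have fK := comatchingK hf.
(* [R] represents the classes: the end of each pair that is enumerated first, and every unmatched
   vertex. *)
pose R := [set x | enum_rank x <= enum_rank (f x)].
have eqR : f @: (~: R) = R :\: unmatched f.
  apply/setP=> x; rewrite -[in LHS](fK x) mem_imset; last exact: (can_inj fK).
  rewrite !inE fK -ltnNge ltn_neqAle; congr (~~ _ && _).
  by rewrite (inj_eq val_inj) (inj_eq enum_rank_inj) eq_sym.
apply: (@colorable_image _ _ (fun x => if x \in R then x else f x) R).
- move=> x; case: ifP => // xR.
  have: f x \in f @: (~: R) by rewrite imset_f // inE xR.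
  by rewrite eqR => /setDP[].
- move=> x y xy; have nxy := adj_neq xy.
  case: ifP => _; case: ifP => _ //.
  + by apply: contraTneq xy => ->; rewrite adj_sym comatching_nadj.
  + by apply: contraTneq xy => <-; rewrite comatching_nadj.
  + by rewrite (inj_eq (can_inj fK)).
- have UR : unmatched f \subset R.
    by apply/subsetP=> x; rewrite !inE => /eqP->.
  have := cardsC R; have := card_imset (~: R) (can_inj fK).
  by rewrite eqR cardsD (setIidPr UR); have := subset_leq_card UR; lia.
Qed.

(** * Bounding the order by the clique number *)

Lemma triangle_clique (G : sgraph) (x y z : G) :
  adj x y -> adj x z -> adj y z ->
  clique [set x; y; z] /\ #|[set x; y; z]| = 3.
Proof.
move=> xy xz yz; split; last first.
  by rewrite setUC cardsU1 cards2 !inE negb_or !adj_neq // adj_sym.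
apply/cliqueP=> a b; rewrite !inE -!orbA.
by do 2![case/or3P=> /eqP->]; rewrite ?eqxx // => _; rewrite // adj_sym.
Qed.

Lemma nonneighbors_clique (G : sgraph) (x : G) :
  alpha_le2 G -> clique (~: (x |: neighbors x)).
Proof.
move=> a2; apply/cliqueP=> y z.
rewrite !inE !negb_or => /andP[yx nxy] /andP[zx nxz] yz.
have := a2 x y z; rewrite (negbTE nxy) (negbTE nxz) /=; apply=> //.
  by rewrite eq_sym.
by rewrite eq_sym.
Qed.

Lemma order_le_degree (G : sgraph) (x : G) :
  alpha_le2 G -> #|G| <= (clique_number G + #|neighbors x|).+1.
Proof.
move=> a2; have := clique_le (nonneighbors_clique x a2).
have := cardsC (x |: neighbors x); rewrite cardsU1 !inE adj_irr /=.
lia.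
Qed.

(** The case R(3,3) = 6 of Ramsey's theorem, with the stable triple excluded by [alpha_le2]. *)
Lemma ramsey33 (G : sgraph) (S : {set G}) :
  alpha_le2 G -> 5 < #|S| -> exists T : {set G}, [/\ T \subset S, clique T & #|T| = 3].
Proof.
move=> a2 S5; have /card_gt0P[x xS] : 0 < #|S| by apply: leq_trans S5.
have subT a b c : a \in S -> b \in S -> c \in S -> [set a; b; c] \subset S.
  by move=> aS bS cS; apply/subsetP=> z; rewrite !inE => /orP[/orP[]|] /eqP->.
case: (ltnP 2 #|S :&: neighbors x|) => [/card_gt2P|degx].
  move=> [a [b [c [[/setIP[aS +] /setIP[bS +] /setIP[cS +]] [ab bc ca]]]]].
  rewrite !inE => xa xb xc.
  rewrite eq_sym in ca.
  have [ab'|] := boolP (adj a b).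
    have [cT T3] := triangle_clique xa xb ab'.
    by exists [set x; a; b]; rewrite subT.
  have [ac'|] := boolP (adj a c).
    have [cT T3] := triangle_clique xa xc ac'.
    by exists [set x; a; c]; rewrite subT.
  have := a2 a b c ab ca bc => /or3P[->|->|bc'] //.
  have [cT T3] := triangle_clique xb xc bc'.
  by exists [set x; b; c]; rewrite subT.
have cB : clique (S :\: (x |: neighbors x)).
  by apply: cliqueS (nonneighbors_clique x a2); rewrite setDE subsetIr.
have: 2 < #|S :\: (x |: neighbors x)|.
  have := cardsID (x |: neighbors x) S.
  have -> : S :&: (x |: neighbors x) = x |: (S :&: neighbors x).
    by rewrite setIUr; congr (_ :|: _); apply/setIidPr; rewrite sub1set.
  by rewrite cardsU1 !inE adj_irr andbF /=; lia.
move=> /card_gt2P[a [b [c [[aB bB cB'] [ab bc ca]]]]].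
move/cliqueP: cB => cB; rewrite eq_sym in ca.
have [cT T3] := triangle_clique (cB _ _ aB bB ab) (cB _ _ aB cB' ca) (cB _ _ bB cB' bc).
have SB z : z \in S :\: (x |: neighbors x) -> z \in S by case/setDP.
by exists [set a; b; c]; rewrite subT // SB.
Qed.

(** By maximality [v] misses some [b] in [K]; three neighbours of [v] in [K] would form K5 - e with
    [v] and [b]. *)
Lemma max_clique_neighbors (G : sgraph) (K : {set G}) v :
  no_K5e G -> clique K -> #|K| = clique_number G -> v \notin K ->
  #|K :&: neighbors v| <= 2.
Proof.
move=> k5 cK eK vK; rewrite leqNgt; apply/negP => K3.
have [b bK nvb] : exists2 b, b \in K & ~~ adj v b.
  apply/exists_inP; apply: contraT; rewrite negb_exists_in => /forall_inP allK.
  have: clique (v |: K).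
    by apply: cliqueU1 => // y /allK; rewrite negbK.
  by move/clique_le; rewrite cardsU1 vK eK add1n ltnn.
apply: (k5 v b (K :&: neighbors v)) => //.
- by apply: contraNneq vK => ->.
- by apply: cliqueS cK; apply: subsetIl.
apply/subsetP=> t; rewrite !inE => /andP[tK vt]; rewrite vt /=.
move/cliqueP: cK; apply=> //; by apply: contraNneq nvb => ->.
Qed.

(** Two vertices of [B] that each see fewer than half of [A] jointly miss some vertex of [A], so
    they must be adjacent. *)
Lemma sparse_clique (G : sgraph) (A B : {set G}) :
  alpha_le2 G -> [disjoint A & B] ->
  {in B, forall w, #|A :&: neighbors w|.*2 < #|A|} -> clique B.
Proof.
move=> a2 dAB sparse; apply/cliqueP=> w w' wB w'B ww'.
have [z zA] : exists2 z, z \in A & z \notin (A :&: neighbors w) :|: (A :&: neighbors w').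
  apply/subsetPn; apply/negP=> /subset_leq_card.
  have := cardsUI (A :&: neighbors w) (A :&: neighbors w').
  by have := sparse w wB; have := sparse w' w'B; lia.
rewrite !inE zA negb_or /= => /andP[nwz nw'z].
have zB : z \notin B by rewrite (disjointFr dAB).
have := a2 w w' z; rewrite (negbTE nwz) (negbTE nw'z) !orbF; apply=> //.
  by apply: contraNneq zB => <-.
by apply: contraNneq zB => <-.
Qed.

(** A vertex outside a maximum clique sees at most two of its vertices, fewer than half of five or
    more. So the rest of the graph is a clique too. *)
Lemma order_le_clique5 (G : sgraph) :
  alpha_le2 G -> no_K5e G -> 4 < clique_number G -> #|G| <= (clique_number G).*2.
Proof.
move=> a2 k5 w5; have [K cK eK] := max_clique G.
have cL : clique (~: K).
  apply: (sparse_clique (A := K)) => //.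
    by rewrite -subsets_disjoint.
  move=> w; rewrite inE => wK; have := max_clique_neighbors k5 cK eK wK.
  by rewrite eK; lia.
by have := clique_le cL; have := cardsC K; rewrite eK; lia.
Qed.

Lemma cliqueU1_neighbors (G : sgraph) (v : G) (T : {set G}) :
  T \subset neighbors v -> clique T -> clique (v |: T) /\ #|v |: T| = #|T|.+1.
Proof.
move=> /subsetP sT cT; split.
  by apply: cliqueU1 => // y /sT; rewrite inE.
rewrite cardsU1; case: (boolP (v \in T)) => // /sT.
by rewrite inE adj_irr.
Qed.

(** [v] and [T] form a maximum clique, of which [w] sees at most two vertices; one of them is
    [v]. *)
Lemma neighbor_triangle4 (G : sgraph) (v w : G) (T : {set G}) :
  no_K5e G -> clique_number G = 4 ->
  T \subset neighbors v -> clique T -> #|T| = 3 -> w \in neighbors v :\: T ->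
  #|T :&: neighbors w| <= 1.
Proof.
move=> k5 w4 sT cT T3 /setDP[]; rewrite inE => vw wT.
have [cK K4] := cliqueU1_neighbors sT cT.
have: #|(v |: T) :&: neighbors w| <= 2.
  apply: max_clique_neighbors => //; first by rewrite K4 T3 w4.
  by rewrite in_setU1 negb_or wT andbT eq_sym adj_neq.
have -> : (v |: T) :&: neighbors w = v |: (T :&: neighbors w).
  by rewrite setIUl; congr (_ :|: _); apply/setIidPl; rewrite sub1set inE adj_sym.
rewrite cardsU1 in_setI; case: (boolP (v \in T)) => //=.
by move/(subsetP sT); rewrite inE adj_irr.
Qed.

Lemma neighbors_two_triangles (G : sgraph) (v : G) (T : {set G}) :
  alpha_le2 G -> no_K5e G -> clique_number G = 4 ->
  T \subset neighbors v -> clique T -> #|T| = 3 ->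
  clique (neighbors v :\: T) /\ #|neighbors v :\: T| <= 3.
Proof.
move=> a2 k5 w4 sT cT T3.
have cT' : clique (neighbors v :\: T).
  apply: (sparse_clique (A := T)) => //.
    by rewrite disjoint_sym -setI_eq0 setDE -setIA (setIC (~: T)) setICr setI0.
  by move=> w wT'; have := neighbor_triangle4 k5 w4 sT cT T3 wT'; lia.
split=> //; have [cK K4] := cliqueU1_neighbors (subsetDl (neighbors v) T) cT'.
by have := clique_le cK; rewrite K4 w4.
Qed.

(** A larger degree is at least 6, so the neighbourhood contains a triangle. With [v] this forces
    omega = 4, and then the neighbourhood splits into two cliques of at most three vertices. *)
Lemma degree_le (G : sgraph) (v : G) :
  alpha_le2 G -> no_K5e G -> 2 < clique_number G < 5 ->
  #|neighbors v| <= clique_number G + 2.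
Proof.
move=> a2 k5 /andP[w2 w5]; rewrite leqNgt; apply/negP=> deg.
have [|T [sT cT T3]] := @ramsey33 G (neighbors v) a2; first by lia.
have [cK K4] := cliqueU1_neighbors sT cT.
have w4 : clique_number G = 4 by have := clique_le cK; lia.
have [_] := neighbors_two_triangles a2 k5 w4 sT cT T3.
by have := cardsID T (neighbors v); rewrite (setIidPr sT); lia.
Qed.

(** Both sides count the pairs of a point and a member of [Q] containing it. *)
Lemma double_count (T : finType) (Q : {set {set T}}) d k :
  (forall A, A \in Q -> #|A| = k) -> (forall x, #|[set A in Q | x \in A]| = d) ->
  #|T| * d = #|Q| * k.
Proof.
move=> Qk xd.
have -> : #|T| * d = \sum_(x : T) \sum_(A in Q | x \in A) 1.
  rewrite -sum_nat_const; apply: eq_bigr => x _.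
  by rewrite -(xd x) -sum1_card; apply: eq_bigl => A; rewrite inE.
rewrite (exchange_big_dep (fun A => A \in Q)) /=; last by move=> x A _ /andP[].
rewrite -sum_nat_const; apply: eq_bigr => A AQ.
by rewrite -(Qk A AQ) -sum1_card; apply: eq_bigl => x; rewrite AQ.
Qed.

(** Double counting with the edges, taken as cliques of size 2, for blocks. *)
Lemma regular_handshake (G : sgraph) d :
  (forall x : G, #|neighbors x| = d) -> ~~ odd (#|G| * d).
Proof.
move=> deg; rewrite (@double_count G [set A | clique A && (#|A| == 2)] d 2).
- by rewrite muln2 odd_double.
- by move=> A; rewrite inE => /andP[_ /eqP].
move=> x; rewrite -(deg x) -[RHS](card_in_imset (f := fun y => [set x; y])).
  apply: eq_card => A; rewrite !inE; apply/idP/imsetP.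
    move=> /andP[/andP[/cliqueP cA /cards2P[a [b [ab eA]]]]].
    have adjab : adj a b by apply: cA; rewrite // eA !inE eqxx ?orbT.
    rewrite {1}eA !inE => /orP[/eqP->|/eqP->].
      by exists b; rewrite ?inE.
    by exists a; rewrite ?inE 1?adj_sym // setUC.
  move=> [y]; rewrite inE => xy ->; rewrite !inE eqxx cards2 adj_neq // eqxx !andbT.
  apply/cliqueP=> a b; rewrite !inE.
  by do 2![case/orP=> /eqP->]; rewrite ?eqxx // adj_sym.
move=> y z; rewrite !inE => xy xz /setP/(_ y); rewrite !inE eqxx orbT.
by rewrite eq_sym (negbTE (adj_neq xy)) => /esym/eqP.
Qed.

(** The neighbourhood splits into two triangles, and any triangle in it shares two vertices with one
    of them, hence equals it. *)
Lemma cliques4_at (G : sgraph) (v : G) :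
  alpha_le2 G -> no_K5e G -> clique_number G = 4 -> #|neighbors v| = 6 ->
  #|[set A in [set A : {set G} | clique A && (#|A| == 4)] | v \in A]| = 2.
Proof.
move=> a2 k5 w4 deg.
have [|T [sT cT T3]] := @ramsey33 G (neighbors v) a2; first by rewrite deg.
have [cT' T'3] := neighbors_two_triangles a2 k5 w4 sT cT T3.
set T' := neighbors v :\: T in cT' T'3.
have sT' : T' \subset neighbors v by apply: subsetDl.
have eT' : #|T'| = 3.
  by have := cardsID T (neighbors v); rewrite (setIidPr sT) -/T'; lia.
have vN : v \notin neighbors v by rewrite inE adj_irr.
have vT : v \notin T by apply: contra vN; apply: subsetP.
have vT' : v \notin T' by apply: contra vN; apply: subsetP.
have [cK K4] := cliqueU1_neighbors sT cT.
have [cK' K'4] := cliqueU1_neighbors sT' cT'.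
have KK' : v |: T != v |: T'.
  apply/eqP=> /(congr1 (fun A => A :\ v)); rewrite !setU1K // => e.
  have : T :&: T' = set0 by rewrite /T' setIC setDE -setIA (setIC (~: T)) setICr setI0.
  by rewrite -e setIid => T0; rewrite T0 cards0 in T3.
(* A vertex of [B] outside [S] would see two vertices of [S], against [neighbor_triangle4]. *)
have far (S B : {set G}) : S \subset neighbors v -> clique S -> #|S| = 3 ->
    B \subset neighbors v -> clique B -> #|B| = 3 ->
    2 <= #|B :&: S| -> B = S.
  move=> sS cS S3 sB cB B3 BS; apply/eqP; rewrite eqEcard B3 S3 leqnn andbT.
  apply: contraT => /subsetPn[w wB wS].
  have wN : w \in neighbors v :\: S by rewrite in_setD wS (subsetP sB).
  have := neighbor_triangle4 k5 w4 sS cS S3 wN; rewrite leqNgt => /negP[].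
  apply: leq_trans BS _; apply/subset_leq_card/subsetP=> z /setIP[zB zS].
  rewrite !inE zS /=; move/cliqueP: cB; apply=> //.
  by apply: contraNneq wS => ->.
transitivity #|[set v |: T; v |: T']|; last by rewrite cards2 KK'.
apply: eq_card => A; rewrite !inE; apply/idP/idP; last first.
  by case/orP=> /eqP->; rewrite setU11 ?cK ?cK' ?K4 ?K'4 ?T3 ?eT'.
move=> /andP[/andP[cA /eqP A4] vA].
have eA : v |: (A :\ v) = A by apply: setD1K.
have A3 : #|A :\ v| = 3 by move: A4; rewrite (cardsD1 v) vA add1n => -[].
have cB : clique (A :\ v) by apply: cliqueS cA; apply: subD1set.
have sA : A :\ v \subset neighbors v.
  apply/subsetP=> z /setD1P[zv zA]; rewrite inE.
  by move/cliqueP: cA; apply=> //; rewrite eq_sym.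
rewrite -eA; have [two|le1] := ltnP 1 #|(A :\ v) :&: T|.
  by rewrite (far T (A :\ v)) // eqxx.
rewrite (far T' (A :\ v)) ?eqxx ?orbT //.
have := cardsID T (A :\ v); rewrite A3.
have -> : (A :\ v) :\: T = (A :\ v) :&: T'.
  by rewrite /T' setIDA; congr (_ :\: _); apply/esym/setIidPl.
move=> e; rewrite -(leq_add2l #|(A :\ v) :&: T|) e.
exact: (leq_add le1 (leqnn 2)).
Qed.

Lemma order_le (G : sgraph) :
  alpha_le2 G -> no_K5e G ->
  #|G| <= (clique_number G).*2.+1 \/
  2 < clique_number G < 5 /\ #|G| <= (clique_number G).*2.+2.
Proof.
move=> a2 k5; set w := clique_number G.
have [w5|w5] := ltnP 4 w; first by left; have := order_le_clique5 a2 k5 w5; lia.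
have [w2|w2] := ltnP 2 w.
  right; split; first by lia.
  rewrite leqNgt; apply/negP=> n_gt.
  have w25 : 2 < clique_number G < 5 by rewrite -/w; lia.
  (* The lower bound of [order_le_degree] meets the upper bound of [degree_le]. *)
  have deg (x : G) : #|neighbors x| = w + 2.
    have := degree_le x a2 k5 w25; have := order_le_degree x a2; rewrite -/w; lia.
  have n_eq : #|G| = w.*2 + 3.
    have /card_gt0P[x _] : 0 < #|G| by lia.
    have := order_le_degree x a2; rewrite (deg x) -/w; lia.
  have [w3|w4] : w = 3 \/ w = 4 by lia.
    by have := regular_handshake deg; rewrite n_eq w3.
  (* Eleven vertices in two K4s each give 22 incidences, which is not a multiple of 4. *)
  have := @double_count G [set A | clique A && (#|A| == 4)] 2 4.
  rewrite n_eq w4 => h.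
  have: (4.*2 + 3) * 2 = #|[set A : {set G} | clique A && (#|A| == 4)]| * 4.
    apply: h => [A|x]; first by rewrite inE => /andP[_ /eqP].
    by apply: cliques4_at => //; rewrite deg w4.
  by lia.
left.
have n5 : #|G| <= 5.
  rewrite leqNgt; apply/negP=> n6.
  have [|T [_ cT T3]] := @ramsey33 G setT a2; first by rewrite cardsT.
  by have := clique_le cT; rewrite T3 leqNgt ltnS w2.
have [w2'|w1] := ltnP 1 w; first by lia.
have n2 : #|G| <= 2.
  rewrite leqNgt; apply/negP=> /card_gt2P[a [b [c [_ [ab bc ca]]]]].
  have edge (x y : G) : adj x y -> False.
    move=> xy; have: clique [set x; y].
      apply/cliqueP=> p q; rewrite !inE.
      by do 2![case/orP=> /eqP->]; rewrite ?eqxx // adj_sym.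
    by move/clique_le; rewrite cards2 adj_neq // leqNgt ltnS w1.
  by rewrite eq_sym in ca; have /or3P[] := a2 a b c ab ca bc; apply: edge.
have [/card0_eq n0|/card_gt0P[x _]] := posnP #|G|; first by rewrite eq_card0.
have: clique [set x] by apply/cliqueP=> p q /set1P-> /set1P->; rewrite eqxx.
by move/clique_le; rewrite cards1 -/w; lia.
Qed.

(** * Two unmatched vertices, and stability number at most two *)

Lemma nonneighbors_exposed (G : sgraph) (f : {ffun G -> G}) u :
  max_comatching f -> u \in unmatched f ->
  #|G| <= (#|neighbors u| + #|exposed f :\: neighbors u|).+1.
Proof.
move=> hmax uU.
have sub : ~: (u |: neighbors u) \subset exposed f :\: neighbors u.
  apply/subsetP=> y; rewrite in_setC in_setU1 negb_or in_setD => /andP[yu nuy].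
  rewrite nuy; rewrite inE in nuy; apply/exposedP; split; last by exists u.
  by apply: contra nuy => yU; rewrite (max_unmatched_adj hmax) // eq_sym.
have := cardsC (u |: neighbors u); rewrite cardsU1 inE adj_irr /=.
by have := subset_leq_card sub; lia.
Qed.

(** A pair has at most one exposed end, because the mate of an exposed vertex sees all unmatched
    vertices. *)
Lemma exposed_half (G : sgraph) (f : {ffun G -> G}) :
  alpha_le2 G -> max_comatching f -> #|exposed f|.*2 + #|unmatched f| <= #|G|.
Proof.
move=> a2 hmax; have [hf _] := hmax; have fK := comatchingK hf.
have eX : #|f @: exposed f| = #|exposed f| by apply: card_imset (can_inj fK).
have XY : exposed f :&: f @: exposed f = set0.
  apply/setP=> z; rewrite in_setI in_set0.
  apply/andP=> -[/exposedP[zU [u uU nuz]] /imsetP[y /exposedP[yU [v vU nvy]] e]].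
  case/negP: nuz; rewrite adj_sym e.
  exact: (mate_adj_unmatched a2 hmax vU).
have sub : exposed f :|: f @: exposed f \subset ~: unmatched f.
  apply/subsetP=> z; rewrite in_setC => /setUP[/exposedP[] //|/imsetP[y /exposedP[yU _] ->]].
  by rewrite unmatched_mate.
have := subset_leq_card sub; have := cardsC (unmatched f).
have := cardsUI (exposed f) (f @: exposed f); rewrite XY cards0 eX.
by lia.
Qed.

(** At order 2 omega + 2 at most omega vertices are exposed, while the degree bound makes each
    unmatched vertex miss at least omega - 1 of them. So each sees at most one, which makes the
    mates pairwise adjacent and yields a clique of omega + 1 vertices. *)
Lemma unmatched2_order (G : sgraph) (f : {ffun G -> G}) :
    alpha_le2 G -> no_K5e G -> max_comatching f -> #|unmatched f| = 2 ->
    2 < clique_number G < 5 ->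
  #|G| != (clique_number G).*2.+2.
Proof.
move=> a2 k5 hmax U2 w25; apply/eqP=> n_eq.
have Yge v : v \in unmatched f -> clique_number G <= #|exposed f :\: neighbors v|.+1.
  move=> vU; have := nonneighbors_exposed hmax vU.
  by have := degree_le v a2 k5 w25; lia.
have := exposed_half a2 hmax; rewrite U2 n_eq => Yle.
have /cards2P[p [q [pq eU]]] : #|unmatched f| == 2 by rewrite U2.
have other u : u \in unmatched f -> exists2 v, v \in unmatched f & u != v.
  rewrite eU !inE => /orP[/eqP->|/eqP->]; first by exists q; rewrite // !inE eqxx orbT.
  by exists p; rewrite ?inE ?eqxx // eq_sym.
have pU : p \in unmatched f by rewrite eU !inE eqxx.
suff hY : {in exposed f &, forall y y', y != y' -> adj (f y) (f y')}.
  have := clique_unmatched_mates a2 hmax hY; rewrite U2.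
  have := Yge p pU; have := subset_leq_card (subsetDl (exposed f) (neighbors p)).
  by lia.
move=> y y' yY y'Y yy'.
have /exposedP[yU [u uU nuy]] := yY; have /exposedP[y'U [u' u'U nu'y']] := y'Y.
have [e|uu'] := eqVneq u u'; last by apply: (mates_adj a2 hmax uU u'U).
rewrite -{u' u'U}e in nu'y'.
have [v vU uv] := other u uU.
have [vy|nvy] := boolP (adj v y); last first.
  by apply: (mates_adj a2 hmax vU uU) => //; rewrite eq_sym.
have [vy'|nvy'] := boolP (adj v y'); last first.
  by apply: (mates_adj a2 hmax uU vU).
(* Here [y] and [y'] miss only [u], so [v] sees two exposed vertices, one too many. *)
have : #|[set y; y']| <= #|exposed f :&: neighbors v|.
  apply/subset_leq_card/subsetP=> z; rewrite in_setI [z \in neighbors v]inE.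
  by case/set2P=> ->; rewrite ?yY ?y'Y.
rewrite cards2 yy' /=; have := cardsID (neighbors v) (exposed f).
by move: (Yge v vU) Yle; clear; lia.
Qed.

Lemma colorable_alpha_le2 (G : sgraph) :
  alpha_le2 G -> no_K5e G -> colorable G (clique_number G).+1.
Proof.
move=> a2 k5; have [f hmax] := ex_max_comatching G; have [hf _] := hmax.
have [U3|U2] := ltnP 2 #|unmatched f|.
  have /existsP[c /forallP c_proper] := colorable_unmatched_ge3 a2 k5 hmax U3.
  apply: (@colorable_image _ _ c setT).
  - by move=> x; rewrite inE.
  - by move=> x y; move/forallP: (c_proper x) => /(_ y) /implyP.
  - by rewrite cardsT card_ord.
apply: (colorable_comatching hf).
have [|[w25]] := order_le a2 k5; first by lia.
have [e|U2'] := eqVneq #|unmatched f| 2; last by lia.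
by have := unmatched2_order a2 k5 hmax e w25; lia.
Qed.

(** * Deleting a large stable set *)

Definition stable (G : sgraph) (I : {set G}) : bool :=
  [forall x in I, forall y in I, ~~ adj x y].

Lemma stableP (G : sgraph) (I : {set G}) :
  reflect {in I &, forall x y, ~~ adj x y} (stable I).
Proof.
apply: (iffP forall_inP) => [h x y xI yI | h x xI].
  by move/forall_inP: (h x xI) => /(_ y yI).
by apply/forall_inP => y yI; apply: h.
Qed.

Lemma clique_stable_dominated (G : sgraph) (I Q : {set G}) :
    no_P3K1 G -> stable I -> 2 < #|I| ->
    (forall v, v \notin I -> exists2 i, i \in I & adj v i) ->
    clique Q -> [disjoint Q & I] ->
  exists2 i, i \in I & {in Q, forall q, adj i q}.
Proof.
move=> p3 /stableP sI I3 domI /cliqueP cQ dQI.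
(* Otherwise i - v - k with [j] is an induced copy of P3 u K1. *)
have only v i j k : i \in I -> j \in I -> k \in I ->
    adj v i -> ~~ adj v j -> adj v k -> k = i.
  move=> iI jI kI vi nvj vk; apply/eqP; apply: contraT => ki; exfalso.
  by apply: (p3 i v k j); first [done|exact: sI|by rewrite eq_sym|by rewrite adj_sym].
have [|] := boolP [forall q in Q, forall i in I, adj i q].
  move=> /forall_inP full; have /card_gt0P[i iI] : 0 < #|I| by apply: leq_trans I3.
  by exists i => // q qQ; have /forall_inP := full q qQ; apply.
rewrite negb_forall_in => /exists_inP[q qQ]; rewrite negb_forall_in.
move=> /exists_inP[j jI njq].
have QI z : z \in Q -> z \notin I by move=> zQ; rewrite (disjointFr dQI).
have [i iI qi] := domI q (QI q qQ).
(* Since [q] misses [j], its only neighbour in [I] is [i]. If [q'] misses [i], it too has a single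
   neighbour [k], and a third vertex [w] of [I] is isolated from the path i - q - q'. *)
exists i => // q' q'Q; have [->|q'q] := eqVneq q' q; first by rewrite adj_sym.
apply: contraT => niq'; exfalso.
have [k kI q'k] := domI q' (QI q' q'Q).
have [w wI wik] : exists2 w, w \in I & w \notin [set i; k].
  apply/subsetPn; apply/negP=> /subset_leq_card; rewrite cards2.
  by rewrite leqNgt => /negP[]; apply: leq_trans I3; case: (i != k).
move: wik; rewrite !inE negb_or => /andP[wi wk].
apply: (p3 i q q' w) => //.
- by apply: contraNneq (QI q' q'Q) => <-.
- by rewrite adj_sym.
- by apply: cQ => //; rewrite eq_sym.
- exact: sI.
- apply: contra wi => wq; apply/eqP/(only q i j w) => //; by rewrite adj_sym.
- apply: contra wk => wq'; apply/eqP/(only q' k i w) => //; by rewrite adj_sym.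
Qed.

Lemma no_K5e_induced (G : sgraph) (S : {set G}) : no_K5e G -> no_K5e (induced S).
Proof.
move=> k5 a b T ab nab /cliqueP cT T3 /subsetP sT.
apply: (k5 (val a) (val b) (val @: T)) => //.
- apply/cliqueP=> _ _ /imsetP[x xT ->] /imsetP[y yT ->] xy.
  exact: (cT x y).
- by rewrite card_imset //; apply: val_inj.
- by apply/subsetP=> _ /imsetP[x xT ->]; have := sT x xT; rewrite !inE.
Qed.

Lemma no_P3K1_induced (G : sgraph) (S : {set G}) :
  no_P3K1 G -> no_P3K1 (induced S).
Proof. by move=> p3 x y z w; apply: (p3 (val x) (val y) (val z) (val w)). Qed.

Lemma colorable_del_stable (G : sgraph) (I : {set G}) k :
  stable I -> colorable (induced (~: I)) k -> colorable G k.+1.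
Proof.
move=> /stableP sI /existsP[c /forallP c_proper].
(* [insub] fails exactly on [I], so [None] is the extra colour. *)
pose g x := omap c (insub x : option (induced (~: I))).
apply: (@colorable_image _ _ g setT); last first.
- by rewrite cardsT card_option card_ord.
- move=> x y xy; rewrite /g.
  case: insubP => [x' x'C ex|]; case: insubP => [y' y'C ey|] //=.
    apply: contraTneq xy => -[e]; have /forallP/(_ y')/implyP := c_proper x'.
    by rewrite e eqxx /= ex ey => h; apply/negP=> /h.
  by rewrite !inE !negbK => yI xI; rewrite (negbTE (sI _ _ xI yI)) in xy.
- by move=> x; rewrite inE.
Qed.

Lemma colorable_clique_number (G : sgraph) :
  no_K5e G -> no_P3K1 G -> colorable G (clique_number G).+1.
Proof.
have [n] := ubnP #|G|; elim: n G => // n IHn G /ltnSE leGn k5 p3.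
have st0 : stable (set0 : {set G}) by apply/stableP=> x y; rewrite inE.
have [I sI maxI] := arg_maxnP (fun I : {set G} => #|I|) st0.
have [I3|I2] := ltnP 2 #|I|; last first.
  apply: colorable_alpha_le2 => // x y z xy xz yz; apply: contraT.
  rewrite !negb_or => /and3P[nxy nxz nyz].
  have: stable [set x; y; z].
    apply/stableP=> a b; rewrite !inE -!orbA.
    by do 2![case/or3P=> /eqP->]; rewrite ?adj_irr // adj_sym.
  move/maxI => /=; rewrite setUC cardsU1 cards2 !inE negb_or.
  by rewrite !(eq_sym z) xy xz yz /= leqNgt ltnS I2.
have domI v : v \notin I -> exists2 i, i \in I & adj v i.
  move=> vI; apply/exists_inP; apply: contraT; rewrite negb_exists_in => /forall_inP nvI.
  have: stable (v |: I).
    apply/stableP=> x y /setU1P[->|xI] /setU1P[->|yI]; rewrite ?adj_irr ?nvI //.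
      by rewrite adj_sym nvI.
    by move/stableP: sI; apply.
  by move/maxI; rewrite /= cardsU1 vI add1n ltnn.
have lt_w : clique_number (induced (~: I)) < clique_number G.
  have [Q' /cliqueP cQ' <-] := max_clique (induced (~: I)).
  have cQ : clique [set val x | x in Q'].
    apply/cliqueP=> _ _ /imsetP[x xQ ->] /imsetP[y yQ ->] xy.
    exact: (cQ' x y).
  have dQI : [disjoint [set val x | x in Q'] & I].
    rewrite disjoint_subset; apply/subsetP=> _ /imsetP[x _ ->].
    by have := valP x; rewrite !inE.
  have [i iI iQ] := clique_stable_dominated p3 sI I3 domI cQ dQI.
  have: clique (i |: [set val x | x in Q']).
    by apply: cliqueU1 => // q qQ _; apply: iQ.
  move/clique_le; rewrite cardsU1 (disjointFl dQI iI) add1n card_imset //.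
  exact: val_inj.
have lt_n : #|induced (~: I)| < n.
  apply: leq_trans leGn; rewrite card_sig -(cardsC I) -[X in X < _]add0n ltn_add2r.
  exact: leq_trans I3.
have /existsP[c /forallP c_proper] :=
  IHn _ lt_n (no_K5e_induced k5) (no_P3K1_induced p3).
(* As [lt_w] shows, the omega + 1 colours used on the rest are at most the clique number of [G],
   which leaves one more colour for [I]. *)
have: colorable (induced (~: I)) (clique_number G).
  apply: (@colorable_image _ _ c setT).
  - by move=> x; rewrite inE.
  - by move=> x y; move/forallP: (c_proper x) => /(_ y) /implyP.
  - by rewrite cardsT card_ord.
exact: colorable_del_stable.
Qed.

Theorem theorem3 (G : sgraph)
    (hK5e : induced_free K5_minus_e G) (hP3K1 : induced_free P3_union_K1 G) :
  chromatic_number G <= clique_number G + 1.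
Proof.
rewrite addn1; apply/chromatic_number_le/colorable_clique_number.
  exact: no_K5e_of_free.
exact: no_P3K1_of_free.
Qed.
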